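(* Let $G=(V,E)$ be a critical graph and write $\omega=\omega(G)$. Then there is a pseudocomplete coloring of $G$ in which $\omega$ colors are used exactly once, on the vertices of a maximal clique, and $\frac{|V|-\omega}{2}$ colors are used exactly twice, on the vertices of the complement of that maximal clique. Moreover, $$|E|\ge \frac{(|V|+\omega)(|V|+\omega-2)}{8}.$$
   Context: All graphs are finite and simple; $|G|=|V|$ denotes the number of vertices of $G$. A coloring of a graph $G=(V,E)$ is a surjective map $\ell:V\to C$ onto a finite set $C$ of colors; it need not be proper. It is pseudocomplete if for any two distinct colors $i,j\in C$ there is an edge $uv\in E$ with $\{\ell(u),\ell(v)\}=\{i,j\}$. The pseudoachromatic number $\Psi(G)$ is the greatest number of colors used in a pseudocomplete coloring of $G$ (so $\Psi$ of the graph with no vertices is $0$). $\omega(G)$ is the clique number, and ''maximal clique'' means a clique with $\omega(G)$ vertices. For an integer $0\le k\le |G|$, $\operatorname{mpd}_G(k)=\min\{\Psi(G)-\Psi(G\setminus X) : X\subseteq V,\ |X|=k\}$, where $G\setminus X$ is the subgraph induced on $V\setminus X$. $G$ is critical if $\operatorname{mpd}_G(k)\ge\lceil k/2\rceil$ for all $0\le k\le |G|$. *)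

(* Defs.v *)
From mathcomp Require Import all_boot.
Set Implicit Arguments.
Unset Strict Implicit.
Unset Printing Implicit Defensive.

Record sgraph := SGraph {
  vertex :> finType;
  adj : rel vertex;
  adj_sym : symmetric adj;
  adj_irrefl : irreflexive adj
}.

Definition edges (G : sgraph) : {set {set G}} :=
  [set A : {set G} |
     [exists u : G, exists v : G, adj u v && (A == [set u; v])]].

Definition induced_adj (G : sgraph) (S : {set G}) : rel {x : G | x \in S} :=
  fun u v => adj (val u) (val v).

Lemma induced_adj_sym (G : sgraph) (S : {set G}) : symmetric (@induced_adj G S).
Proof. by move=> u v; apply: adj_sym. Qed.

Lemma induced_adj_irrefl (G : sgraph) (S : {set G}) :
  irreflexive (@induced_adj G S).
Proof. by move=> u; apply: adj_irrefl. Qed.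

Definition induced (G : sgraph) (S : {set G}) : sgraph :=
  SGraph (@induced_adj_sym G S) (@induced_adj_irrefl G S).

Definition remove (G : sgraph) (X : {set G}) : sgraph := induced (~: X).

Definition is_clique (G : sgraph) (K : {set G}) : bool :=
  [forall u in K, forall v in K, (u != v) ==> adj u v].

Definition clique_number (G : sgraph) : nat :=
  \max_(K : {set G} | is_clique K) #|K|.

(* A clique of maximum cardinality, not merely maximal under inclusion. *)
Definition maximal_clique (G : sgraph) (K : {set G}) : bool :=
  is_clique K && (#|K| == clique_number G).

Definition coloring (G : sgraph) (C : finType) (l : G -> C) : bool :=
  [forall c : C, exists v : G, l v == c].

Definition pseudocomplete (G : sgraph) (C : finType) (l : G -> C) : bool :=
  [forall i : C, forall j : C, (i != j) ==>
     [exists u : G, exists v : G,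
        adj u v && ([set l u; l v] == [set i; j])]].

(* Colorings are onto, so at most #|G| colors can occur and the bound on k
   loses nothing. *)
Definition pseudoachromatic (G : sgraph) : nat :=
  \max_(k < #|G|.+1 |
     [exists l : {ffun G -> 'I_k}, coloring l && pseudocomplete l]) k.

(* The pseudoachromatic number is monotone under induced subgraphs, so the
   subtraction is never truncated. The neutral element [pseudoachromatic G]
   dominates every term, so this is the true minimum whenever k <= #|G|. *)
Definition mpd (G : sgraph) (k : nat) : nat :=
  \big[minn/pseudoachromatic G]_(X : {set G} | #|X| == k)
     (pseudoachromatic G - pseudoachromatic (remove X)).

(* uphalf k is the ceiling of k / 2. *)
Definition critical (G : sgraph) : Prop :=
  forall k : nat, k <= #|G| -> uphalf k <= mpd G k.

Definition color_class (G : sgraph) (C : finType) (l : G -> C) (c : C) :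
  {set G} := [set v | l v == c].

Definition colors_used (G : sgraph) (C : finType) (l : G -> C) (m : nat) :
  {set C} := [set c | #|color_class l c| == m].

(* Main.v *)
Require Import Defs.
From mathcomp Require Import all_boot all_order all_algebra.
From mathcomp Require Import zify lra.
Set Implicit Arguments.
Unset Strict Implicit.
Unset Printing Implicit Defensive.
Import Order.TTheory GRing.Theory Num.Theory.
Local Open Scope ring_scope.

(** Write n for the number of vertices, w for the clique number and Psi for
the pseudoachromatic number. The theorem is the equality case of an upper
bound on Psi that criticality forces to be attained.

Upper bound. In a pseudocomplete coloring the vertices that are alone in their
color class form a clique ([singleton_vertices_clique]), so at most w classes
are singletons. All other classes have at least two vertices, hence
2 Psi <= n + w, and equality forces w singletons and no class of size above 2
([colors_leqif]).

Lower bound. Deleting the complement of a maximum clique K leaves a complete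
graph, whose pseudoachromatic number is at least w. Criticality says that
deleting these n - w vertices costs at least (n - w) / 2 colors, so
2 Psi >= n + w ([critical_lower_bound]).

The bound on the edges follows from Psi = (n + w) / 2, because distinct pairs
of colors of a pseudocomplete coloring are realized by distinct edges
([pseudocomplete_edges]). *)

Lemma pseudocompleteP (G : sgraph) (C : finType) (l : G -> C) :
  reflect (forall i j, i != j -> exists u v, [/\ adj u v, l u = i & l v = j])
          (pseudocomplete l).
Proof.
apply: (iffP forallP) => [pl i j ij | pl i].
  have /forallP/(_ j)/implyP/(_ ij)/existsP[u /existsP[v /andP[uv /eqP E]]] :=
    pl i.
  have := set21 i j; have := set22 i j; rewrite -E !inE.
  move=> /orP[] /eqP jE /orP[] /eqP iE; last 2 first.
  - by exists u, v.
  - by move: ij; rewrite jE iE eqxx.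
  - by move: ij; rewrite jE iE eqxx.
  - by exists v, u; rewrite adj_sym.
apply/forallP => j; apply/implyP => /pl[u [v [uv <- <-]]].
by apply/existsP; exists u; apply/existsP; exists v; rewrite uv eqxx.
Qed.

Lemma coloringP (G : sgraph) (C : finType) (l : G -> C) :
  reflect (forall c, exists v, l v = c) (coloring l).
Proof.
by apply: (iffP forallP) => cl c; [have /existsP[v /eqP] := cl c | apply/existsP;
  have [v <-] := cl c]; exists v.
Qed.

Lemma is_cliqueP (G : sgraph) (K : {set G}) :
  reflect {in K &, forall u v, u != v -> adj u v} (is_clique K).
Proof.
apply: (iffP forall_inP) => [cK u v uK vK | cK u uK].
  by have /forall_inP/(_ v vK)/implyP := cK u uK.
by apply/forall_inP => v vK; apply/implyP; apply: cK.
Qed.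

(** The definition of the pseudoachromatic number only looks at colors in
['I_k]; relabelling reduces an arbitrary finite color type to that case. *)
Lemma card_colors_leq_pseudoachromatic (G : sgraph) (C : finType) (l : G -> C) :
  coloring l -> pseudocomplete l -> (#|C| <= pseudoachromatic G)%N.
Proof.
move=> /coloringP cl /pseudocompleteP pl.
have leCG : (#|C| < #|G|.+1)%N.
  have <- : #|codom l| = #|C|.
    by apply: eq_card => c; have [v <-] := cl c; rewrite codom_f.
  by rewrite ltnS leq_image_card.
pose f : {ffun G -> 'I_#|C|} := [ffun v => enum_rank (l v)].
rewrite /pseudoachromatic (bigD1 (Ordinal leCG)) /= ?leq_maxl //.
apply/existsP; exists f; apply/andP; split.
  apply/coloringP => c; have [v lv] := cl (enum_val c).
  by exists v; rewrite ffunE lv enum_valK.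
apply/pseudocompleteP => i j; rewrite -(inj_eq enum_val_inj).
move=> /pl[u [v [uv lu lv]]]; exists u, v.
by rewrite !ffunE lu lv !enum_valK.
Qed.

Lemma pseudoachromatic_attained (G : sgraph) :
  exists l : G -> 'I_(pseudoachromatic G), coloring l /\ pseudocomplete l.
Proof.
rewrite /pseudoachromatic.
pose P := [pred k : 'I_#|G|.+1 |
  [exists l : {ffun G -> 'I_k}, coloring l && pseudocomplete l]].
(* Some number of colors is feasible: none for the empty graph, one otherwise. *)
have [k0 Pk0] : exists k, P k.
  have [G0 | /card_gt0P[v0 _]] := posnP #|G|.
    exists ord0; apply/existsP.
    exists [ffun v => False_rect _ (notF (etrans (esym (card0_eq G0 v)) isT))].
    by apply/andP; split; apply/forallP; case.
  have G1 : (1 < #|G|.+1)%N by rewrite ltnS; apply/card_gt0P; exists v0.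
  exists (Ordinal G1); apply/existsP; exists [ffun=> ord0].
  apply/andP; split.
    by apply/coloringP => c; exists v0; rewrite ffunE [RHS]ord1.
  by apply/pseudocompleteP => i j; rewrite [i]ord1 [j]ord1 eqxx.
have Pgt0 : (0 < #|P|)%N by apply/card_gt0P; exists k0.
have [k /existsP[l /andP[cl pl]] ->] := eq_bigmax_cond (@nat_of_ord _) Pgt0.
by exists l.
Qed.

Lemma mpd_leq (G : sgraph) (X : {set G}) :
  (mpd G #|X| <= pseudoachromatic G - pseudoachromatic (remove X))%N.
Proof.
rewrite /mpd; have := mem_index_enum X.
elim: (index_enum _) => //= Y s IHs; rewrite inE big_cons.
case/predU1P => [<- | /IHs le_s]; first by rewrite eqxx geq_minl.
by case: ifP => // _; apply: leq_trans (geq_minr _ _) le_s.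
Qed.

(** The identity is a pseudocomplete coloring of a complete graph. *)
Lemma complete_pseudoachromatic (G : sgraph) :
  is_clique [set: G] -> (#|G| <= pseudoachromatic G)%N.
Proof.
move=> /is_cliqueP cG; apply: (@card_colors_leq_pseudoachromatic G G id).
  by apply/coloringP => v; exists v.
by apply/pseudocompleteP => u v uv; exists u, v; split=> //; apply: cG.
Qed.

Lemma card_induced (G : sgraph) (S : {set G}) : #|induced S| = #|S|.
Proof. by rewrite card_sig; apply: eq_card. Qed.

Lemma critical_lower_bound (G : sgraph) :
  critical G -> (#|G| + clique_number G <= 2 * pseudoachromatic G)%N.
Proof.
move=> critG.
have clique0 : (0 < #|[pred K : {set G} | is_clique K]|)%N.
  apply/card_gt0P; exists set0; apply/is_cliqueP => u v; first by rewrite inE.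
have [K cK ->] :=
  eq_bigmax_cond (fun K : {set G} => #|K|) clique0 : {K | _ & clique_number G = _}.
move/is_cliqueP: cK => cK.
have le_K : (#|K| <= pseudoachromatic (remove (~: K)))%N.
  rewrite -[X in (#|pred_of_set X| <= _)%N]setCK -card_induced.
  apply: complete_pseudoachromatic; apply/is_cliqueP => u v _ _ uv.
  have inK (w : remove (~: K)) : val w \in K by case: w => w /=; rewrite setCK.
  exact: cK (inK u) (inK v) uv.
have := leq_trans (critG #|~: K| (max_card _)) (mpd_leq _).
have cardG : (#|K| + #|~: K| = #|G|)%N by rewrite cardsC.
(* When K is everything, criticality only says that a truncated difference is
   at least 0; there the identity coloring of the complete graph G is used. *)
have [K'0 _ | K'gt0] := posnP #|~: K|; last by lia.
have KT : K = [set: G] by rewrite -[K]setCK (cards0_eq K'0) setC0.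
rewrite KT in cK cardG *.
by have := complete_pseudoachromatic (introT (is_cliqueP _) cK); lia.
Qed.

(** A singleton class can only be joined to another class through its unique
vertex, so two singleton classes force an edge between their vertices. *)
Lemma singleton_vertices_clique (G : sgraph) (C : finType) (l : G -> C) :
  pseudocomplete l -> is_clique [set v | l v \in colors_used l 1].
Proof.
move=> /pseudocompleteP pl.
have alone u v : l u \in colors_used l 1 -> l v = l u -> v = u.
  rewrite inE => /cards1P[x clx] lv.
  have : v \in color_class l (l u) by rewrite inE lv.
  have : u \in color_class l (l u) by rewrite inE.
  by rewrite clx !inE => /eqP-> /eqP.
apply/is_cliqueP => u v; rewrite inE => u1; rewrite inE => v1 uv.
have luv : l u != l v by apply: contra_neq uv => /(alone _ _ v1).
have [u' [v' [uv' lu lv]]] := pl _ _ luv.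
by rewrite -(alone _ _ u1 lu) -(alone _ _ v1 lv).
Qed.

Lemma sum_color_class (G : sgraph) (C : finType) (l : G -> C) (A : {set C}) :
  (\sum_(c in A) #|color_class l c| = #|[set v | l v \in A]|)%N.
Proof.
rewrite -sum1_card (partition_big l [in A]) /= => [|v]; last by rewrite inE.
apply: eq_bigr => c Ac; rewrite sum1dep_card.
by apply: eq_card => v; rewrite !inE; case: eqP => [->|]; rewrite ?Ac ?andbF.
Qed.

Lemma card_colors_used_vertices (G : sgraph) (C : finType) (l : G -> C) m :
  (#|[set v | l v \in colors_used l m]| = #|colors_used l m| * m)%N.
Proof.
rewrite -sum_color_class -sum_nat_const.
by apply: eq_bigr => c; rewrite inE => /eqP.
Qed.

(** Double counting: a singleton class is charged twice, once as a vertex and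
once as a singleton, so that every class is charged at least 2, with equality
exactly when it has at most two vertices. *)
Lemma colors_leqif (G : sgraph) (C : finType) (l : G -> C) :
  coloring l ->
  (2 * #|C| <= #|G| + #|colors_used l 1|
     ?= iff [forall c, #|color_class l c| <= 2])%N.
Proof.
move=> /coloringP cl.
have -> : (2 * #|C| = \sum_(c : C) 2)%N by rewrite sum_nat_const mulnC.
have -> : (#|G| + #|colors_used l 1| =
           \sum_(c : C) (#|color_class l c| + (c \in colors_used l 1)))%N.
  rewrite big_split /=; congr addn; last first.
    by rewrite -sum1_card big_mkcond; apply: eq_bigr => c _; case: (_ \in _).
  rewrite -cardsT; have := sum_color_class l [set: C].
  under eq_bigl do rewrite inE; move=> ->.
  by apply: eq_card => v; rewrite !inE.
apply: leqif_sum => c _; rewrite inE.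
have : (0 < #|color_class l c|)%N.
  by have [v <-] := cl c; apply/card_gt0P; exists v; rewrite inE.
by case: #|_| => [|[|[|m]]].
Qed.

(** The image of edges under the coloring covers all pairs of colors. *)
Lemma pseudocomplete_edges (G : sgraph) (C : finType) (l : G -> C) :
  pseudocomplete l -> ('C(#|C|, 2) <= #|edges G|)%N.
Proof.
move=> /pseudocompleteP pl; rewrite -card_draws.
apply: leq_trans (leq_imset_card (fun A : {set G} => l @: A) _).
apply/subset_leq_card/subsetP => B; rewrite inE => /cards2P[i [j [ij ->]]].
have [u [v [uv <- <-]]] := pl _ _ ij.
apply/imsetP; exists [set u; v]; last by rewrite imsetU1 imset_set1.
by rewrite inE; apply/existsP; exists u; apply/existsP; exists v; rewrite uv eqxx.
Qed.

Theorem theorem3p7 (G : sgraph) (hG : critical G) :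
  (exists (K : {set G}) (C : finType) (l : G -> C),
     [/\ maximal_clique K,
         coloring l /\ pseudocomplete l,
         #|colors_used l 1| = clique_number G /\
         [set v | l v \in colors_used l 1] = K
       & #|colors_used l 2|%:R =
           (#|G|%:R - (clique_number G)%:R) / 2 :> rat /\
         [set v | l v \in colors_used l 2] = ~: K]) /\
  (#|edges G|%:R : rat) >=
    (#|G|%:R + (clique_number G)%:R) *
    (#|G|%:R + (clique_number G)%:R - 2) / 8.
Proof.
have [l [cl pl]] := pseudoachromatic_attained G.
have lower := critical_lower_bound hG.
have [upper tight] := colors_leqif cl; rewrite card_ord in upper tight.
set K := [set v | l v \in colors_used l 1].
have cK : is_clique K := singleton_vertices_clique pl.
have cardK : #|K| = #|colors_used l 1| by rewrite card_colors_used_vertices muln1.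
have leKw : (#|K| <= clique_number G)%N by apply: leq_bigmax_cond cK.
have cardKw : #|K| = clique_number G by lia.
have Psi2 : (2 * pseudoachromatic G = #|G| + clique_number G)%N by lia.
have le2 : forall c, (#|color_class l c| <= 2)%N.
  by apply/forallP; rewrite -tight; lia.
have used2 : colors_used l 2 = ~: colors_used l 1.
  apply/setP => c; rewrite !inE; have := le2 c.
  have : (0 < #|color_class l c|)%N.
    by have [v <-] := coloringP _ cl c; apply/card_gt0P; exists v; rewrite inE.
  by case: #|_| => [|[|[|m]]].
have vertices2 : [set v | l v \in colors_used l 2] = ~: K.
  by apply/setP => v; rewrite used2 !inE.
split.
  exists K, _, l; split=> //; first by rewrite /maximal_clique cK cardKw eqxx.
    by rewrite -cardK.
  split=> //.
  have cardG : (#|G| = clique_number G + #|colors_used l 2| * 2)%N.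
    by rewrite -card_colors_used_vertices vertices2 -cardKw cardsC.
  by rewrite cardG natrD natrM; lra.
have := pseudocomplete_edges pl; rewrite card_ord.
rewrite -(ler_nat rat); apply: le_trans.
have Psi2R : (#|G|%:R + (clique_number G)%:R : rat)
             = 2 * (pseudoachromatic G)%:R by rewrite -natrD -Psi2 natrM.
rewrite Psi2R; set p := pseudoachromatic G.
have : (2 * 'C(p, 2) + p = p * p)%N.
  by rewrite bin2; have := odd_double_half (p * p.-1); rewrite oddM; nia.
move=> /(congr1 (fun m => m%:R : rat)); rewrite natrD !natrM; nra.
Qed.
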